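(* Let $S\in\mathcal{S}^d_m$, $G\in\mathcal{M}(S)$, $j\in\{1,\dots,d\}$, and assume that $D:=\operatorname{int}\operatorname{dom}\psi_G\ne\emptyset$. Let $\delta>0$. For every $n\ge1$, there exist a compact set $C_n\subset G-G$ with $$x^j>0,\ \ x\in C_n,\qquad\text{and}\qquad 0\le S(x,x)\le\delta,\ \ x\in\theta^j(C_n),$$ and a function $h_n\in\mathcal{H}^j_{\theta^j(C_n)}$ such that $$\overline{\Sigma}^j_0(P_G)\subset\bigcup_{n}\{x\in\mathbb{R}^d:\ h_n(Sx)=0\}.$$ For any $\epsilon>0$, all $C_n$ can be chosen such that $\operatorname{diam}\theta^j(C_n)<\epsilon$.
   Context: $\mathcal{S}^d_m$ is the set of invertible symmetric real $d\times d$ matrices with exactly $m\in\{0,1,\dots,d\}$ positive eigenvalues. For $S\in\mathcal{S}^d_m$, $S(x,y)=\langle x,Sy\rangle$ for $x,y\in\mathbb{R}^d$. $\mathcal{M}(S)$ is the family of closed non-empty $S$-monotone sets $G\subset\mathbb{R}^d$, i.e. $S(x-y,x-y)\ge0$ for all $x,y\in G$. For such $G$, and $x\in\mathbb{R}^d$, $$\psi_G(x)=\sup_{y\in G}\Big(S(x,y)-\tfrac12S(y,y)\Big)\in\mathbb{R}\cup\{+\infty\},\qquad P_G(x)=\operatorname*{arg\,min}_{y\in G}S(x-y,x-y)$$ (the possibly empty set of minimizers), and $\operatorname{dom}\psi_G=\{x:\psi_G(x)<\infty\}$. $\overline{\Sigma}^j_0(P_G)$ is the set of $x\in\mathbb{R}^d$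 for which there exist $y_1,y_2\in P_G(x)$ with $y_1^j\ne y_2^j$ and $S(y_1-y_2,y_1-y_2)=0$. $G-G=\{a-b:a,b\in G\}$; $\operatorname{diam}E=\sup_{x,y\in E}|x-y|$ (Euclidean norm). $x^j$ is the $j$th coordinate of $x\in\mathbb{R}^d$ and $x^{-j}\in\mathbb{R}^{d-1}$ is $x$ with its $j$th coordinate removed. For a compact set $C\subset\{x\in\mathbb{R}^d: x^j>0\}$, $\theta^j(C)=\{y/y^j: y\in C\}$, a compact set all of whose elements have $j$th coordinate $1$. For a compact set $C$ all of whose elements have $j$th coordinate equal to $1$, $\mathcal{H}^j_C$ is the family of functions $h$ on $\mathbb{R}^d$ of the form $$h(x)=x^j+g_1(x^{-j})-g_2(x^{-j}),$$ where $g_1,g_2:\mathbb{R}^{d-1}\to\mathbb{R}$ are convex, have linear growth ($|g_i(u)|\le K(1+|u|)$ for some constant $K>0$ and all $u$), and $\nabla h(x)\in C$ whenever both $g_1$ and $g_2$ are differentiable at $x^{-j}$.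
   Formalization: The set $\overline{\Sigma}^j_0(P_G)$ is assumed non-empty; otherwise the claim can fail, e.g. for $d=1$, $S=(1)$, $G=\{0\}$, where $C_n$ must be empty and no $h_n\in\mathcal{H}^j_{\emptyset}$ exists. *)

(* Defs.v *)
From HB Require Import structures.
From mathcomp Require Import all_boot all_order all_algebra.
From mathcomp Require Import all_classical all_reals all_analysis.

Set Implicit Arguments.
Unset Strict Implicit.
Unset Printing Implicit Defensive.

Import Order.TTheory GRing.Theory Num.Theory.
Import numFieldNormedType.Exports.

Local Open Scope classical_set_scope.
Local Open Scope ring_scope.

(* Points of R^d are column vectors.  The norm `|x| that the library puts on
   'cV[R]_d is the sup norm; it gives the usual topology (closed, compact,
   interior, differentiable), but [diam] and the growth condition below use the
   Euclidean norm [enorm]. *)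
Definition enorm (R : realType) (d : nat) (x : 'cV[R]_d) : R :=
  Num.sqrt (\sum_(i < d) x i 0 ^+ 2).

(* Eigenvalues are counted with multiplicity; the characteristic polynomial of
   a real symmetric matrix splits over R, so a list [s] always exists. *)
Definition num_pos_eigenvalues (R : realType) (d : nat) (S : 'M[R]_d)
    (m : nat) : Prop :=
  exists s : seq R,
    char_poly S = \prod_(a <- s) ('X - a%:P) /\ count (fun a => 0 < a) s = m.

Definition Sdm (R : realType) (d m : nat) : set 'M[R]_d :=
  [set S | [/\ S^T = S, S \in unitmx & num_pos_eigenvalues S m]].

Definition bform (R : realType) (d : nat) (S : 'M[R]_d) (x y : 'cV[R]_d) : R :=
  (x^T *m (S *m y)) 0 0.

Definition S_monotone (R : realType) (d : nat) (S : 'M[R]_d)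
    (G : set 'cV[R]_d) : Prop :=
  forall x y, G x -> G y -> 0 <= bform S (x - y) (x - y).

Definition monotone_sets (R : realType) (d : nat) (S : 'M[R]_d) :
    set (set 'cV[R]_d) :=
  [set G | [/\ closed G, G !=set0 & S_monotone S G]].

Definition psi (R : realType) (d : nat) (S : 'M[R]_d) (G : set 'cV[R]_d)
    (x : 'cV[R]_d) : \bar R :=
  ereal_sup [set (bform S x y - 2^-1 * bform S y y)%:E | y in G].

Definition dom_psi (R : realType) (d : nat) (S : 'M[R]_d) (G : set 'cV[R]_d) :
    set 'cV[R]_d :=
  [set x | (psi S G x < +oo)%E].

Definition proj (R : realType) (d : nat) (S : 'M[R]_d) (G : set 'cV[R]_d)
    (x : 'cV[R]_d) : set 'cV[R]_d :=
  [set y | G y /\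
    forall z, G z -> bform S (x - y) (x - y) <= bform S (x - z) (x - z)].

Definition Sigma0 (R : realType) (d : nat) (S : 'M[R]_d) (G : set 'cV[R]_d)
    (j : 'I_d) : set 'cV[R]_d :=
  [set x | exists y1 y2, [/\ proj S G x y1, proj S G x y2,
      y1 j 0 != y2 j 0 & bform S (y1 - y2) (y1 - y2) = 0]].

Definition diff_set (R : realType) (d : nat) (G : set 'cV[R]_d) :
    set 'cV[R]_d :=
  [set x | exists a b, [/\ G a, G b & x = a - b]].

Definition diam (R : realType) (d : nat) (E : set 'cV[R]_d) : \bar R :=
  ereal_sup [set r | exists x y, [/\ E x, E y & r = (enorm (x - y))%:E]].

Definition theta (R : realType) (d : nat) (j : 'I_d) (C : set 'cV[R]_d) :
    set 'cV[R]_d :=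
  [set (y j 0)^-1 *: y | y in C].

Definition grad (R : realType) (d : nat) (h : 'cV[R]_d -> R) (x : 'cV[R]_d) :
    'cV[R]_d :=
  \col_i 'D_(delta_mx i 0) h x.

Definition linear_growth (R : realType) (n : nat) (g : 'cV[R]_n -> R) : Prop :=
  exists K : R, 0 < K /\ forall u, `|g u| <= K * (1 + enorm u).

(* [row' j x] is x with its j-th coordinate removed.
   For [C = set0] this family is empty, because two convex functions always
   have a common point of differentiability. *)
Definition Hfam (R : realType) (d : nat) (j : 'I_d) (C : set 'cV[R]_d) :
    set ('cV[R]_d -> R) :=
  [set h : 'cV[R]_d -> R | exists g1 g2 : 'cV[R]_d.-1 -> R,
    [/\ convex_function setT g1 /\ convex_function setT g2,
        linear_growth g1 /\ linear_growth g2,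
        forall x : 'cV[R]_d, h x = x j 0 + g1 (row' j x) - g2 (row' j x) &
        forall x : 'cV[R]_d, differentiable g1 (row' j x) ->
          differentiable g2 (row' j x) -> C (grad h x)]].

(* Since [Hfam j set0] is empty, each [C n] here is nonempty; when
   [Sigma0 S G j] is empty no such set need exist (e.g. if G is a singleton). *)
Definition covering (R : realType) (d : nat) (S : 'M[R]_d) (G : set 'cV[R]_d)
    (j : 'I_d) (delta : R)
    (C : nat -> set 'cV[R]_d) (h : nat -> 'cV[R]_d -> R) : Prop :=
  (forall n,
    [/\ compact (C n), C n `<=` diff_set G,
        forall x, C n x -> 0 < x j 0,
        forall x, theta j (C n) x -> 0 <= bform S x x <= delta &
        Hfam j (theta j (C n)) (h n)]) /\
  Sigma0 S G j `<=` \bigcup_n [set x | h n (S *m x) = 0].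

(* Main.v *)
(* For u = S x, a point y of P_G(x) maximizes <u, y> - S(y, y) / 2 over G.
   Take two small compact pieces A1, A2 of G whose j-th coordinates are
   separated by p < q, with A1 above A2, and let f1, f2 be the corresponding
   maxima over A1 and A2.  As f1 - f2 is strictly increasing in u^j, the
   equation f1 = f2 is solved by a unique u^j = g(u^{-j}).  Let w(u^{-j}) be the
   common value.  For b in [p, q], w - b g is the minimum over u^j of
   max(f1, f2) - b u^j, hence convex; since
   g = ((w - p g) - (w - q g)) / (q - p), the function h = x^j - g(x^{-j}) is
   of the required form.  Any maximizers y1, y2 at the crossing point provide
   supporting functions of w and give D w + y^j D h = y for y = y1, y2, that is
   D h = (y1 - y2) / (y1^j - y2^j).  The remaining constraints on A1 - A2 are
   open conditions that hold at a pair with S(y1 - y2, y1 - y2) = 0, so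
   countably many pairs of boxes with rational centers are enough. *)
Require Import Defs.
From HB Require Import structures.
From mathcomp Require Import all_boot all_order all_algebra.
From mathcomp Require Import all_classical all_reals all_analysis.
From mathcomp Require Import ring lra.

Set Implicit Arguments.
Unset Strict Implicit.
Unset Printing Implicit Defensive.

Import Order.TTheory GRing.Theory Num.Theory.
Import numFieldNormedType.Exports.

Local Open Scope classical_set_scope.
Local Open Scope ring_scope.

(** * Entrywise continuity, the sup norm and compactness of column vectors *)

Lemma continuous_matrix (T U : topologicalType) (m n : nat)
    (f : T -> 'M[U]_(m, n)) (x : T) :
  (forall i j, {for x, continuous (fun y => f y i j)}) ->
  {for x, continuous f}.
Proof.
move=> fc A [P fP PA].
apply: (filterS (P := fun y => forall i j, P i j (f y i j))).
  by move=> y Py; exact: PA.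
by apply: filter_forall => i; apply: filter_forall => j; exact/fc/fP.
Qed.

Lemma mx_coord_le (R : realType) (m n : nat) (x : 'M[R]_(m, n)) i j :
  `|x i j| <= `|x|.
Proof.
by rewrite [leRHS]/Num.norm/= mx_normrE; apply/bigmax_geP; right; exists (i, j).
Qed.

Lemma mx_norm_le (R : realType) (m n : nat) (x : 'M[R]_(m, n)) (e : R) :
  0 <= e -> (forall i j, `|x i j| <= e) -> `|x| <= e.
Proof.
move=> e0 xe; rewrite [leLHS]/Num.norm/= mx_normrE.
by apply/bigmax_leP; split=> // -[i j] _ /=.
Qed.

(** Heine-Borel for row vectors, carried over to columns by transposition, which is continuous and
    preserves the sup norm. *)
Lemma cV_bounded_closed_compact (R : realType) (d : nat) (A : set 'cV[R]_d) :
  bounded_set A -> closed A -> compact A.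
Proof.
have tc m n : continuous (fun x : 'M[R]_(m, n) => x^T).
  move=> x; apply: continuous_matrix => i k.
  rewrite (_ : (fun y => _) = (fun y : 'M[R]_(m, n) => y k i)).
    exact: coord_continuous.
  by apply/funext => y; rewrite mxE.
move=> bA cA.
have -> : A = (fun x : 'rV[R]_d => x^T) @` ((fun x : 'rV[R]_d => x^T) @^-1` A).
  apply/seteqP; split => [x Ax|_ [x Ax <-]//].
  by exists x^T; rewrite /= trmxK.
apply: continuous_compact; first by apply: continuous_subspaceT; exact: tc.
apply: bounded_closed_compact; last first.
  by apply: closed_comp => [x _|]; [exact: tc|].

case: bA => M [Mr bA]; exists M; split=> // e /bA {}bA x /= /bA.
move=> bx; rewrite -[x]trmxK; apply: mx_norm_le => [|i k].
  exact: le_trans bx.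
by rewrite mxE; exact: le_trans (mx_coord_le _ _ _) bx.
Qed.

(** * Dot product, Euclidean norm and the form [bform] *)

Definition dot (R : realType) (n : nat) (u v : 'cV[R]_n) : R :=
  \sum_i u i 0 * v i 0.

Lemma dotDl (R : realType) (n : nat) (u v w : 'cV[R]_n) :
  dot (u + v) w = dot u w + dot v w.
Proof. by rewrite -big_split; apply: eq_bigr => i _; rewrite mxE mulrDl. Qed.

Lemma dotZl (R : realType) (n : nat) (a : R) (u v : 'cV[R]_n) :
  dot (a *: u) v = a * dot u v.
Proof. by rewrite /dot mulr_sumr; apply: eq_bigr => i _; rewrite mxE mulrA. Qed.

Lemma dot_row' (R : realType) (d : nat) (j : 'I_d) (u v : 'cV[R]_d) :
  dot u v = dot (row' j u) (row' j v) + u j 0 * v j 0.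
Proof.
rewrite /dot (bigD1_ord j)//= addrC; congr (_ + _).
by apply: eq_bigr => i _; rewrite !mxE.
Qed.

Lemma dot_delta (R : realType) (n : nat) (i : 'I_n) (v : 'cV[R]_n) :
  dot (delta_mx i 0) v = v i 0.
Proof.
rewrite /dot (bigD1 i)//= mxE !eqxx mul1r big1 ?addr0// => k ki.
by rewrite mxE (negPf ki) mul0r.
Qed.

Lemma enorm_coord_le (R : realType) (n : nat) (u : 'cV[R]_n) i :
  `|u i 0| <= enorm u.
Proof.
rewrite -sqrtr_sqr ler_sqrt; last by apply: sumr_ge0 => k _; exact: sqr_ge0.
by rewrite (bigD1 i)//= lerDl sumr_ge0// => k _; exact: sqr_ge0.
Qed.

Lemma enorm_le (R : realType) (n : nat) (u : 'cV[R]_n) :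
  enorm u <= n%:R * `|u|.
Proof.
rewrite -[leRHS]ger0_norm ?mulr_ge0// -sqrtr_sqr ler_sqrt ?sqr_ge0//.
apply: (@le_trans _ _ (\sum_(i < n) `|u| ^+ 2)).
  apply: ler_sum => i _; rewrite -real_normK ?num_real//.
  by rewrite lerXn2r ?nnegrE//; exact: mx_coord_le.
rewrite sumr_const card_ord exprMn -[leLHS]mulr_natl.
apply: ler_wpM2r; first exact: sqr_ge0.
by rewrite -natrX ler_nat; case: n {u} => // n; rewrite expnS expn1 leq_pmulr.
Qed.

Lemma normr_dot_le (R : realType) (n : nat) (u v : 'cV[R]_n) (M : R) :
  0 <= M -> (forall i, `|v i 0| <= M) -> `|dot u v| <= n%:R * M * enorm u.
Proof.
move=> M0 vM; apply: le_trans (ler_norm_sum _ _ _) _.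
apply: (@le_trans _ _ (\sum_(i < n) enorm u * M)).
  by apply: ler_sum => i _; rewrite normrM ler_pM// enorm_coord_le.
by rewrite sumr_const card_ord -[leLHS]mulr_natl mulrA mulrAC.
Qed.

Lemma continuous_dotr (R : realType) (n : nat) (u : 'cV[R]_n) :
  continuous (dot u).
Proof.
apply: continuous_big => [|i _ x]; first exact: add_continuous.
by apply: continuousM; [exact: cst_continuous|exact: coord_continuous].
Qed.

Lemma bformE (R : realType) (d : nat) (S : 'M[R]_d) (x y : 'cV[R]_d) :
  bform S x y = dot x (S *m y).
Proof. by rewrite /bform mxE; apply: eq_bigr => i _; rewrite mxE. Qed.

Lemma bform_sym (R : realType) (d : nat) (S : 'M[R]_d) (x y : 'cV[R]_d) :
  S^T = S -> bform S x y = bform S y x.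
Proof.
move=> SS; rewrite /bform -[in LHS](trmxK (x^T *m _)) mxE.
by rewrite !trmx_mul SS trmxK mulmxA.
Qed.

Lemma bformDr (R : realType) (d : nat) (S : 'M[R]_d) (x y z : 'cV[R]_d) :
  bform S x (y + z) = bform S x y + bform S x z.
Proof. by rewrite /bform !mulmxDr mxE. Qed.

Lemma bformDl (R : realType) (d : nat) (S : 'M[R]_d) (x y z : 'cV[R]_d) :
  bform S (x + y) z = bform S x z + bform S y z.
Proof. by rewrite !bformE dotDl. Qed.

Lemma bformZr (R : realType) (d : nat) (S : 'M[R]_d) (a : R) (x y : 'cV[R]_d) :
  bform S x (a *: y) = a * bform S x y.
Proof. by rewrite /bform -!scalemxAr mxE. Qed.

Lemma bformZl (R : realType) (d : nat) (S : 'M[R]_d) (a : R) (x y : 'cV[R]_d) :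
  bform S (a *: x) y = a * bform S x y.
Proof. by rewrite !bformE dotZl. Qed.

Lemma bform_sqrB (R : realType) (d : nat) (S : 'M[R]_d) (x y : 'cV[R]_d) :
  S^T = S ->
  bform S (x - y) (x - y) = bform S x x - 2 * bform S x y + bform S y y.
Proof.
move=> SS; rewrite bformDl !bformDr -scaleN1r bformZl !bformZr.
by rewrite bformZl (bform_sym y x SS); ring.
Qed.

Lemma bform_continuous (R : realType) (d : nat) (S : 'M[R]_d) :
  continuous (fun x => bform S x x).
Proof.
have -> : (fun x => bform S x x) =
    (fun x => \sum_i x i 0 * dot (row i S)^T x).
  apply/funext => x; rewrite bformE; apply: eq_bigr => i _; rewrite mxE.
  by congr (_ * _); apply: eq_bigr => k _; rewrite !mxE.
apply: continuous_big => [|i _ x]; first exact: add_continuous.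
by apply: continuousM; [exact: coord_continuous|exact: continuous_dotr].
Qed.

Lemma row'_continuous (R : realType) (d n : nat) (j : 'I_d) :
  continuous (row' j : 'M[R]_(d, n) -> 'M[R]_(d.-1, n)).
Proof.
move=> x; apply: continuous_matrix => i k.
rewrite (_ : (fun y => _) = (fun y : 'M[R]_(d, n) => y (lift j i) k)).
  exact: coord_continuous.
by apply/funext => y; rewrite mxE.
Qed.

(** * Crossing of two maxima: existence, uniqueness, convexity and growth *)

(** The two slope bounds make [F] Lipschitz, hence continuous, and the lower one forces a change of
    sign; the intermediate value theorem concludes. *)
Lemma monotone_lipschitz_root (R : realType) (F : R -> R) (k K : R) :
  0 < k -> (forall s t, s <= t -> k * (t - s) <= F t - F s <= K * (t - s)) ->
  exists t, F t = 0.
Proof.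
move=> k0 FkK.
have FK s t : `|F s - F t| <= K * `|s - t|.
  wlog st : s t / s <= t.
    move=> H; case/orP: (le_total s t) => [/H//|/H].
    by rewrite distrC [X in K * X]distrC.
  have /andP[h1 h2] := FkK _ _ st.
  rewrite distrC [X in K * X]distrC [`|t - s|]ger0_norm ?subr_ge0// ger0_norm//.
  by apply: le_trans h1; rewrite mulr_ge0 ?subr_ge0// ltW.
have K0 : 0 <= K by have := FK 1 0; rewrite subr0 normr1 mulr1; exact: le_trans.
have cF : continuous F.
  move=> x; apply/cvgrPdist_lt => /= e e0; near=> y.
  apply: le_lt_trans (FK _ _) _; apply: (@le_lt_trans _ _ ((K + 1) * `|x - y|)).
    by rewrite ler_wpM2r// lerDl.
  rewrite mulrC -ltr_pdivlMr ?ltr_wpDl//.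
  by near: y; apply: cvgr_dist_lt => //; rewrite divr_gt0// ltr_wpDl.
(* With slope at least [k], a move of length [T] to the right or left outweighs the value [F 0]. *)
pose T := `|F 0| / k.
have T0 : 0 <= T by rewrite divr_ge0// ltW.
have kT : k * T = `|F 0| by rewrite mulrC divfK ?gt_eqF.
have FT : 0 <= F T.
  have /andP[h _] := FkK _ _ T0; have := ler_norm (- F 0); rewrite normrN.
  by move: h; rewrite subr0 kT; lra.
have FNT : F (- T) <= 0.
  have NT0 : - T <= 0 by rewrite oppr_le0.
  have /andP[h _] := FkK _ _ NT0; have := ler_norm (F 0).
  by move: h; rewrite sub0r opprK kT; lra.
have [t _ Ft] : exists2 t, t \in `[- T, T] & F t = 0.
  apply: IVT; first by rewrite (le_trans _ T0)// oppr_le0.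
    exact: continuous_subspaceT.
  by rewrite ge_min le_max FNT FT orbT.
by exists t.
Unshelve. all: by end_near. Qed.

Definition argmax (R : realType) (T : Type) (A : set T) (f : T -> R) : set T :=
  [set y | A y /\ forall z, A z -> f z <= f y].

(* The function y |-> <x, y> - c y, for x with x^{-j} = u and x^j = t. *)
Definition aff (R : realType) (d : nat) (j : 'I_d) (c : 'cV[R]_d -> R)
    (u : 'cV[R]_d.-1) (t : R) (y : 'cV[R]_d) : R :=
  dot u (row' j y) + t * y j 0 - c y.

Lemma aff_shift (R : realType) (d : nat) (j : 'I_d) (c : 'cV[R]_d -> R) u s t y :
  aff j c u t y = aff j c u s y + (t - s) * y j 0.
Proof. by rewrite /aff; ring. Qed.

Lemma argmax_aff_exists (R : realType) (d : nat) (j : 'I_d) (c : 'cV[R]_d -> R)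
    (A : set 'cV[R]_d) u t :
  continuous c -> compact A -> A !=set0 -> argmax A (aff j c u t) !=set0.
Proof.
move=> cc cA A0.
have cf : continuous (aff j c u t).
  rewrite (_ : aff j c u t =
    (fun y => dot u (row' j y)) + (fun y => t * y j 0) - c); last exact/funext.
  move=> y; apply: continuousB; last exact: cc.
  apply: continuousD.
    apply: (@continuous_comp _ _ _ (row' j) (dot u)).
      exact: row'_continuous.
    exact: continuous_dotr.
  by apply: continuousM; [exact: cst_continuous|exact: coord_continuous].
have [y Ay my] := compact_EVT_max A0 cA (continuous_subspaceT cf).
by exists y; split=> [|z Az]; [exact: set_mem|apply: my; exact: mem_set].
Qed.

(** Says that [t] solves f1 = f2 above [u]. Carrying the maximizers as witnesses replaces f1 and f2
    as functions and keeps at hand the points that later give the gradient. *)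
Definition crossing (R : realType) (d : nat) (j : 'I_d) (c : 'cV[R]_d -> R)
    (A1 A2 : set 'cV[R]_d) (u : 'cV[R]_d.-1) (t : R) (y1 y2 : 'cV[R]_d) : Prop :=
  [/\ argmax A1 (aff j c u t) y1, argmax A2 (aff j c u t) y2 &
      aff j c u t y1 = aff j c u t y2].

Definition coord_separated (R : realType) (d : nat) (j : 'I_d) (p q : R)
    (A1 A2 : set 'cV[R]_d) : Prop :=
  [/\ p < q, forall y, A1 y -> q <= y j 0 & forall y, A2 y -> y j 0 <= p].

Lemma compact_coord_bounded (R : realType) (d : nat) (A : set 'cV[R]_d)
    (c : 'cV[R]_d -> R) : continuous c -> compact A ->
  exists M : R, 0 <= M /\ forall y, A y ->
    (forall i, `|y i 0| <= M) /\ `|c y| <= M.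
Proof.
move=> cc cA.
have /ex_strict_bound_gt0[M1 M10 b1] := compact_bounded cA.
have /compact_bounded/ex_strict_bound_gt0[M2 M20 b2] :=
  continuous_compact (continuous_subspaceT cc) cA.
exists (M1 + M2); split; first by rewrite addr_ge0// ltW.
move=> y Ay; split => [i|].
  apply: le_trans (mx_coord_le _ _ _) _.
  by apply: le_trans (ltW (b1 _ Ay)) _; rewrite lerDl ltW.
have := b2 (c y); apply: contraPP => /negP; rewrite -ltNge => h.
move=> /(_ (imageP c Ay)); apply/negP; rewrite -leNgt ltW//.
by apply: le_lt_trans h; rewrite lerDr ltW.
Qed.

(** In [t], the maximum over [A1] has slope in [q, M1] and the one over [A2] slope in [-M2, p], so
    their difference [F] has slope in [q - p, M1 + M2] and vanishes somewhere. *)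
Lemma crossing_exists (R : realType) (d : nat) (j : 'I_d) (c : 'cV[R]_d -> R)
    (A1 A2 : set 'cV[R]_d) (p q : R) u :
  continuous c -> compact A1 -> compact A2 -> A1 !=set0 -> A2 !=set0 ->
  coord_separated j p q A1 A2 ->
  exists t y1 y2, crossing j c A1 A2 u t y1 y2.
Proof.
move=> cc c1 c2 n1 n2 [pq s1 s2].
have [M1 [M10 b1]] := compact_coord_bounded cc c1.
have [M2 [M20 b2]] := compact_coord_bounded cc c2.
have /choice[Y1 Y1P] t := argmax_aff_exists j u t cc c1 n1.
have /choice[Y2 Y2P] t := argmax_aff_exists j u t cc c2 n2.
pose F t := aff j c u t (Y1 t) - aff j c u t (Y2 t).
have [|s t st|t Ft] := @monotone_lipschitz_root R F (q - p) (M1 + M2).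
- by rewrite subr_gt0.
- have [Ys1 ms1] := Y1P s; have [Yt1 mt1] := Y1P t.
  have [Ys2 ms2] := Y2P s; have [Yt2 mt2] := Y2P t.
  have ts0 : 0 <= t - s by rewrite subr_ge0.
  (* Each maximizer at one of the parameters [s], [t] is a competitor at the other; this bounds the
     increments of both maxima from both sides. *)
  have := mt1 _ Ys1; have := ms1 _ Yt1; have := mt2 _ Ys2; have := ms2 _ Yt2.
  rewrite !(aff_shift j c u s t) => h1 h2 h3 h4.
  have k1 := ler_wpM2l ts0 (s1 _ Ys1).
  have k2 := ler_wpM2l ts0 (s2 _ Yt2).
  have k3 := ler_wpM2l ts0 (le_trans (ler_norm _) ((b1 _ Yt1).1 j)).
  have k4 := ler_wpM2l ts0 (le_trans (ler_norm _) ((b2 _ Ys2).1 j)).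
  have : - M2 <= Y2 s j 0 by have := (b2 _ Ys2).1 j; rewrite ler_norml => /andP[].
  move=> /(ler_wpM2l ts0); rewrite /F !(aff_shift j c u s t).
  by move: h1 h2 h3 h4 k1 k2 k3 k4; set a := t - s; lra.
exists t, (Y1 t), (Y2 t); split=> //.
by apply/eqP; rewrite -subr_eq0; apply/eqP.
Qed.

(** If s < t, then from [s] to [t] the maximum over [A1] would gain strictly more than the one over
    [A2], so they could not agree at both. Used in both directions, this gives uniqueness of the
    crossing parameter. *)
Lemma crossing_le (R : realType) (d : nat) (j : 'I_d) (c : 'cV[R]_d -> R)
    (A1 A2 : set 'cV[R]_d) (p q : R) u t y1 y2 s z1 z2 :
  coord_separated j p q A1 A2 ->
  crossing j c A1 A2 u t y1 y2 -> crossing j c A1 A2 u s z1 z2 -> t <= s.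
Proof.
move=> [pq s1 s2] [[y1A m1] [y2A m2] e] [[z1A n1] [z2A n2] e'].
rewrite leNgt; apply/negP => st.
have := m1 _ z1A; have := n2 _ y2A; rewrite e !(aff_shift j c u s t).
have : 0 < (t - s) * (z1 j 0 - y2 j 0).
  rewrite mulr_gt0 ?subr_gt0//.
  exact: le_lt_trans (s2 _ y2A) (lt_le_trans pq (s1 _ z1A)).
by rewrite mulrBr; lra.
Qed.

(** This is convexity of w - b g. For fixed [y], [aff] is affine in the pair (u, t), so a maximizer
    at the combined point can be tested against both endpoints. *)
Lemma crossing_convex (R : realType) (d : nat) (j : 'I_d) (c : 'cV[R]_d -> R)
    (A1 A2 : set 'cV[R]_d) (p q a b : R) u t y1 y2 v s z1 z2 r x1 x2 :
  coord_separated j p q A1 A2 -> 0 <= a <= 1 -> p <= b <= q ->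
  crossing j c A1 A2 u t y1 y2 -> crossing j c A1 A2 v s z1 z2 ->
  crossing j c A1 A2 (a *: u + (1 - a) *: v) r x1 x2 ->
  aff j c (a *: u + (1 - a) *: v) r x1 - b * r <=
    a * (aff j c u t y1 - b * t) + (1 - a) * (aff j c v s z1 - b * s).
Proof.
move=> [pq s1 s2] /andP[a0 a1] /andP[pb bq] [[y1A m1] [y2A m2] e].
move=> [[z1A n1] [z2A n2] e'] [[x1A l1] [x2A l2] e2].
set z := _ + _ *: v in l1 l2 e2 *.
(* The combination [tau] may differ from the crossing parameter [r]; the error (tau - r) x^j is
   compared with (tau - r) b below. *)
pose tau := a * t + (1 - a) * s.
have key x w w' : aff j c u t x <= w -> aff j c v s x <= w' ->
    aff j c z r x + (tau - r) * x j 0 <= a * w + (1 - a) * w'.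
  move=> /(ler_wpM2l a0) h /(ler_wpM2l (_ : 0 <= 1 - a)).
  rewrite subr_ge0 => /(_ a1) h'.
  apply: le_trans (lerD h h'); rewrite le_eqVlt; apply/orP; left; apply/eqP.
  by rewrite /aff /z dotDl !dotZl /tau; ring.
have k1 := key _ _ _ (m1 _ x1A) (n1 _ x1A).
have k2 := key _ _ _ (m2 _ x2A) (n2 _ x2A).
(* The sign of tau - r decides which maximizer to use: [x1], with x1^j >= q >= b, or [x2], with x2^j
   <= p <= b. *)
have [rt|/ltW tr] := leP r tau.
  have : 0 <= (tau - r) * (x1 j 0 - b).
    by rewrite mulr_ge0 ?subr_ge0// (le_trans bq)// s1.
  by move: k1; rewrite /tau; lra.
have : 0 <= (r - tau) * (b - x2 j 0).
  by rewrite mulr_ge0 ?subr_ge0// (le_trans (s2 _ x2A)).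
by move: k2; rewrite -e -e' -e2 /tau; lra.
Qed.

Lemma enorm_ge0 (R : realType) (n : nat) (u : 'cV[R]_n) : 0 <= enorm u.
Proof. exact: sqrtr_ge0. Qed.

(** The crossing equation expresses t (y1^j - y2^j) through terms of linear growth in [u], and the
    factor of [t] is at least q - p. *)
Lemma crossing_growth (R : realType) (d : nat) (j : 'I_d) (c : 'cV[R]_d -> R)
    (A1 A2 : set 'cV[R]_d) (p q : R) :
  continuous c -> compact A1 -> compact A2 -> coord_separated j p q A1 A2 ->
  exists2 K : R, 0 <= K & forall u t y1 y2, crossing j c A1 A2 u t y1 y2 ->
    `|t| <= K * (1 + enorm u) /\ `|aff j c u t y1| <= K * (1 + enorm u).
Proof.
move=> cc c1 c2 [pq s1 s2].
have [M1 [M10 b1]] := compact_coord_bounded cc c1.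
have [M2 [M20 b2]] := compact_coord_bounded cc c2.
pose N := d.-1%:R * (M1 + M2) + (M1 + M2).
have N0 : 0 <= N by rewrite !addr_ge0// mulr_ge0// addr_ge0.
have qp : 0 < q - p by rewrite subr_gt0.
have lin u (y : 'cV[R]_d) (M : R) : M <= M1 + M2 ->
    (forall i, `|y i 0| <= M) /\ `|c y| <= M ->
    `|dot u (row' j y)| + `|c y| <= N * (1 + enorm u).
  move=> MM [yM cM]; have M0 : 0 <= M by apply: le_trans cM.
  have du : `|dot u (row' j y)| <= d.-1%:R * M * enorm u.
    by apply: normr_dot_le => // i; rewrite mxE.
  have e0 := enorm_ge0 u; have n0 : 0 <= d.-1%:R :> R by [].
  apply: (le_trans (lerD du cM)); rewrite /N mulrDr mulr1 addrC.
  apply: lerD; first by rewrite (le_trans MM)// lerDr mulr_ge0// addr_ge0.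
  rewrite ler_wpM2r// (le_trans (ler_wpM2l n0 MM))// lerDl.
  by rewrite addr_ge0.
pose L := 2 * N / (q - p).
have L0 : 0 <= L by rewrite divr_ge0// ?mulr_ge0// ltW.
(* [N] bounds the dot product and [c], [L] bounds [t], and [L * M1] bounds t y1^j, each up to the
   factor 1 + |u|. *)
exists (N + L * (M1 + 1)).
  by rewrite addr_ge0// mulr_ge0// addr_ge0.
move=> u t y1 y2 [[y1A _] [y2A _] e].
have MM1 : M1 <= M1 + M2 by rewrite lerDl.
have MM2 : M2 <= M1 + M2 by rewrite lerDr.
have l1 := lin u _ _ MM1 (b1 _ y1A).
have l2 := lin u _ _ MM2 (b2 _ y2A).
have E0 : 0 <= 1 + enorm u by rewrite addr_ge0// enorm_ge0.
have tL : `|t| <= L * (1 + enorm u).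
  rewrite /L mulrAC ler_pdivlMr//.
  apply: (@le_trans _ _ `|t * (y1 j 0 - y2 j 0)|).
    rewrite normrM ler_wpM2l// (le_trans _ (ler_norm _))//.
    by apply: lerB; [exact: s1|exact: s2].
  have -> : t * (y1 j 0 - y2 j 0) =
      (dot u (row' j y2) - c y2) - (dot u (row' j y1) - c y1).
    by move: e; rewrite /aff => e; lra.
  apply: le_trans (ler_normB _ _) _.
  have := ler_normB (dot u (row' j y2)) (c y2).
  have := ler_normB (dot u (row' j y1)) (c y1).
  by lra.
split.
  by apply: le_trans tL _; rewrite ler_wpM2r// mulrDr mulr1;
    have := mulr_ge0 L0 M10; lra.
have ty : `|t * y1 j 0| <= L * (1 + enorm u) * M1.
  by rewrite normrM ler_pM// (b1 _ y1A).1.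
rewrite /aff; apply: le_trans (ler_normB _ _) _.
have := ler_normD (dot u (row' j y1)) (t * y1 j 0).
have := mulr_ge0 L0 E0.
by move: ty l1; rewrite !mulrDl; lra.
Qed.

(** * Differentiation at a crossing and construction of [h] *)

(** Along the line, difference quotients are at most [a] for negative steps and at least [a] for
    positive ones; both one-sided limits equal the derivative. *)
Lemma derive_support (R : realType) (V : normedModType R) (f : V -> R) (x v : V)
    (a : R) :
  derivable f x v -> (forall s : R, f x + s * a <= f (s *: v + x)) ->
  'D_v f x = a.
Proof.
move=> df fs; apply/eqP; rewrite eq_le; apply/andP; split.
  rewrite /derive cvg_at_leftE; last exact: df.
  apply: limr_le.
    apply: cvgP; apply: cvg_trans df; apply: cvg_app.
    move=> A [e egt0 Ae]; exists e => // y ye ylt0; apply: Ae => //.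
    exact/ltr0_neq0.
  near=> h; have h0 : h < 0 by near: h; exists 1 => /=.
  rewrite /= /shift/= -[_ *: _]/(_ * _) mulrC ler_ndivrMr//.
  by rewrite lerBrDl mulrC.
rewrite /derive cvg_at_rightE; last exact: df.
apply: limr_ge.
  apply: cvgP; apply: cvg_trans df; apply: cvg_app.
  move=> A [e egt0 Ae]; exists e => // y ye ygt0; apply: Ae => //.
  exact/lt0r_neq0.
near=> h; have h0 : 0 < h by near: h; exists 1 => /=.
rewrite /= /shift/= -[_ *: _]/(_ * _) mulrC ler_pdivlMr//.
by rewrite lerBrDl mulrC.
Unshelve. all: by end_near. Qed.

Lemma row'_differentiable (R : realType) (d : nat) (j : 'I_d) (x : 'cV[R]_d) :
  differentiable (row' j : 'cV[R]_d -> 'cV[R]_d.-1) x.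
Proof.
apply: (linear_differentiable (f := row' j)); exact: row'_continuous.
Qed.

Lemma convex_setTP (R : realType) (E : lmodType R) (g : E -> R) :
  (forall (a : R) u v, 0 <= a <= 1 ->
    g (a *: u + (1 - a) *: v) <= a * g u + (1 - a) * g v) ->
  convex_function setT g.
Proof. by move=> gc t u v _ _; apply: gc; rewrite ge0/= le1. Qed.

Lemma Hfam_crossing (R : realType) (d : nat) (j : 'I_d) (c : 'cV[R]_d -> R)
    (A1 A2 : set 'cV[R]_d) (p q : R) :
  continuous c -> compact A1 -> compact A2 -> A1 !=set0 -> A2 !=set0 ->
  coord_separated j p q A1 A2 ->
  exists2 h, Hfam j (theta j [set a - b | a in A1 & b in A2]) h &
    forall x y1 y2, crossing j c A1 A2 (row' j x) (x j 0) y1 y2 -> h x = 0.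
Proof.
move=> cc c1 c2 n1 n2 s12.
have /choice[f fP] (u : 'cV[R]_d.-1) : exists r : R * ('cV[R]_d * 'cV[R]_d),
    crossing j c A1 A2 u r.1 r.2.1 r.2.2.
  have [t [y1 [y2 cr]]] := crossing_exists u cc c1 c2 n1 n2 s12.
  by exists (t, (y1, y2)).
pose g u := (f u).1; pose w u := aff j c u (g u) (f u).2.1.
(* Dividing by q - p already here makes [g] exactly [phi p - phi q]. *)
pose phi b u := (w u - b * g u) / (q - p).
have [pq s1 s2] := s12.
have qp : 0 < q - p by rewrite subr_gt0.
(* [w] and [g] are combinations of [phi p] and [phi q], so both are
   differentiable wherever these two are. *)
have gE u : g u = phi p u - phi q u.
  by rewrite /phi -mulrBl; field; rewrite subr_eq0 gt_eqF.
have wE u : w u = q * phi p u - p * phi q u.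
  by rewrite /phi; field; rewrite subr_eq0 gt_eqF.
have phi_convex b : p <= b <= q -> convex_function setT (phi b).
  move=> pbq; apply: convex_setTP => a u v a01.
  rewrite /phi !mulrA -mulrDl ler_pM2r ?invr_gt0//.
  exact: (crossing_convex s12 a01 pbq (fP u) (fP v)
    (fP (a *: u + (1 - a) *: v))).
have phi_growth b : linear_growth (phi b).
  have [K K0 KP] := crossing_growth cc c1 c2 s12.
  pose L := K * (1 + `|b|) / (q - p).
  have L0 : 0 <= L by rewrite divr_ge0 ?(ltW qp)// mulr_ge0// addr_ge0.
  exists (L + 1); split=> [|u]; first by rewrite ltr_wpDl.
  have [tK wK] := KP _ _ _ _ (fP u).
  rewrite /phi normrM normfV [`|q - p|]gtr0_norm// ler_pdivrMr//.
  apply: (@le_trans _ _ (L * (1 + enorm u) * (q - p))); last first.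
    rewrite ler_wpM2r ?(ltW qp)// ler_wpM2r ?lerDl//.
    by rewrite addr_ge0// enorm_ge0.
  rewrite /L mulrAC divfK ?gt_eqF//.
  apply: le_trans (ler_normB _ _) _; rewrite normrM.
  have := ler_wpM2l (normr_ge0 b) tK.
  by move: wK; rewrite -/(g u) -/(w u); lra.
pose h (x : 'cV[R]_d) := x j 0 + phi q (row' j x) - phi p (row' j x).
have hE x : h x = x j 0 - g (row' j x) by rewrite /h gE; lra.
exists h; last first.
  (* By uniqueness of the crossing parameter, x^j = g(x^{-j}). *)
  move=> x y1 y2 cr; rewrite hE; apply/eqP; rewrite subr_eq0 eq_le.
  by rewrite (crossing_le s12 cr (fP _)) (crossing_le s12 (fP _) cr).
exists (phi q), (phi p); split=> [||//|x dq dp].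
- by split; apply: phi_convex; rewrite lexx ltW.
- by split; exact: phi_growth.
have dQ : differentiable (phi q \o row' j) x.
  by apply: differentiable_comp => //; exact: row'_differentiable.
have dP : differentiable (phi p \o row' j) x.
  by apply: differentiable_comp => //; exact: row'_differentiable.
have dh v : derivable h x v.
  apply: diff_derivable; apply: differentiableB => //.
  by apply: differentiableD => //; exact: differentiable_coord.
pose W z := w (row' j z).
have dW v : derivable W x v.
  have -> : W = q *: (phi p \o row' j) - p *: (phi q \o row' j).
    by apply/funext => z; rewrite /W wE.
  by apply: diff_derivable; apply: differentiableB; exact: differentiableZ.
(* In aff(z, y) + y^j h(z) the terms in [g] cancel and leave <z, y> - c y. This affine function of
   [z] lies below W + y^j h and touches it at [x], so it determines the derivative there. *)
have grad_eq y v :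
    (forall z, aff j c (row' j z) (g (row' j z)) y <= W z) ->
    aff j c (row' j x) (g (row' j x)) y = W x ->
    'D_v W x + y j 0 * 'D_v h x = dot v y.
  move=> Wz Wx; rewrite -[y j 0 * _]/(y j 0 *: _) -deriveZ// -deriveD//.
    apply: derive_support => [|s].
      by apply: derivableD => //; exact: derivableZ.
    have fE z : aff j c (row' j z) (g (row' j z)) y + y j 0 * h z =
        dot z y - c y.
      by rewrite hE (dot_row' j) /aff; ring.
    have := Wz (s *: v + x); rewrite -(lerD2r (y j 0 * h (s *: v + x))) fE.
    apply: le_trans; rewrite !fctE -[(y j 0 \*: h) x]/(y j 0 * h x) -Wx fE.
    by rewrite dotDl dotZl; lra.
  exact: derivableZ.
set u := row' j x; have [[y1A m1] [y2A m2] e] := fP u.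
set y1 := (f u).2.1 in y1A m1 e; set y2 := (f u).2.2 in y2A m2 e.
have y12 : 0 < (y1 - y2) j 0.
  by rewrite !mxE subr_gt0 (le_lt_trans (s2 _ y2A))// (lt_le_trans pq)// s1.
exists (y1 - y2); first by exists y1 => //; exists y2.
apply/matrixP => i k; rewrite ord1 {k} [LHS]mxE [RHS]mxE.
have e1 : 'D_(delta_mx i 0) W x + y1 j 0 * 'D_(delta_mx i 0) h x = y1 i 0.
  rewrite (@grad_eq y1) ?dot_delta// => z.
  by have [[_ m] _ _] := fP (row' j z); exact: m.
have e2 : 'D_(delta_mx i 0) W x + y2 j 0 * 'D_(delta_mx i 0) h x = y2 i 0.
  rewrite (@grad_eq y2) ?dot_delta// => z.
  by have [_ [_ m] e'] := fP (row' j z); rewrite /W /w e'; exact: m.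
(* Subtracting the identities for [y1] and [y2] eliminates the derivative of [W]. *)
have -> : (y1 - y2) i 0 = (y1 - y2) j 0 * 'D_(delta_mx i 0) h x.
  by move: e1 e2; rewrite !mxE; lra.
by rewrite mulKf ?gt_eqF.
Qed.

(** * Projections as maximizers, and pairs of cells *)

(* [proj] alone would denote a projection of the library. *)
Lemma proj_argmax (R : realType) (d : nat) (S : 'M[R]_d) (G A : set 'cV[R]_d)
    (j : 'I_d) (x y : 'cV[R]_d) :
  S^T = S -> A `<=` G -> Defs.proj S G x y -> A y ->
  let f := aff j (fun z => 2^-1 * bform S z z) (row' j (S *m x)) ((S *m x) j 0) in
  argmax A f y /\ forall z, G z -> f z <= f y.
Proof.
move=> SS AG [Gy my] Ay f.
have fE z : f z = bform S x z - 2^-1 * bform S z z.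
  rewrite /f /aff -dot_row' (bform_sym x z SS) [bform S z x]bformE; congr (_ - _).
  by apply: eq_bigr => i _; rewrite mulrC.
suff H z : G z -> f z <= f y by split; [split=> // z /AG; exact: H|exact: H].
(* S(x - z, x - z) = S(x, x) - 2 f(z), so minimizing the left side maximizes [f]. *)
by move=> /my; rewrite !fE !bform_sqrB//; lra.
Qed.

Definition cell_good (R : realType) (d : nat) (S : 'M[R]_d) (j : 'I_d)
    (delta eps : R) (A1 A2 : set 'cV[R]_d) : Prop :=
  [/\ exists p q, coord_separated j p q A1 A2,
      forall x, theta j [set a - b | a in A1 & b in A2] x ->
        bform S x x <= delta &
      forall x y, theta j [set a - b | a in A1 & b in A2] x ->
        theta j [set a - b | a in A1 & b in A2] y -> enorm (x - y) <= eps].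

(** Projections of [x] lying in the two cells both maximize the same function over all of [G], so
    their values agree and they form a crossing at [S *m x], where [h] vanishes. *)
Lemma cell_cover (R : realType) (d : nat) (S : 'M[R]_d) (G : set 'cV[R]_d)
    (j : 'I_d) (delta eps : R) (A1 A2 : set 'cV[R]_d) :
  S^T = S -> S_monotone S G -> A1 `<=` G -> A2 `<=` G ->
  compact A1 -> compact A2 -> A1 !=set0 -> A2 !=set0 ->
  cell_good S j delta eps A1 A2 ->
  exists (C : set 'cV[R]_d) (h : 'cV[R]_d -> R),
    [/\ [/\ compact C, C `<=` diff_set G,
        forall x, C x -> 0 < x j 0,
        forall x, theta j C x -> 0 <= bform S x x <= delta &
        Hfam j (theta j C) h],
        (diam (theta j C) <= eps%:E)%E &
        forall x y1 y2, A1 y1 -> A2 y2 ->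
          Defs.proj S G x y1 -> Defs.proj S G x y2 ->
          h (S *m x) = 0].
Proof.
move=> SS mG AG1 AG2 c1 c2 n1 n2 [[p [q s12]] Sd De].
have cc : continuous (fun z : 'cV[R]_d => 2^-1 * bform S z z).
  move=> z; apply: (@continuousM R _ (fun=> 2^-1) (fun y => bform S y y)).
    exact: cst_continuous.
  exact: bform_continuous.
have [h Hh h0] := Hfam_crossing cc c1 c2 n1 n2 s12.
have [pq s1 s2] := s12.
exists [set a - b | a in A1 & b in A2], h; split.
- split=> //.
  + have -> : [set a - b | a in A1 & b in A2] =
        (fun z : 'cV[R]_d * 'cV[R]_d => z.1 - z.2) @` (A1 `*` A2).
      apply/seteqP; split=> [_ [a Aa [b Ab <-]]|_ [[a b] [/= Aa Ab] <-]].
        by exists (a, b).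
      by exists a => //; exists b.
    apply: continuous_compact; last exact: compact_setX.
    apply: continuous_subspaceT => z.
    by apply: continuousB; [exact: cvg_fst|exact: cvg_snd].
  + by move=> _ [a Aa [b Ab <-]]; exists a, b; split; [exact: AG1|exact: AG2|].
  + move=> _ [a Aa [b Ab <-]]; rewrite !mxE subr_gt0.
    exact: le_lt_trans (s2 _ Ab) (lt_le_trans pq (s1 _ Aa)).
  (* The lower bound is monotonicity of [G]: normalizing a difference multiplies the form by a
     square. *)
  + move=> x tx; rewrite Sd// andbT; case: tx => _ [a Aa [b Ab <-]] <-.
    rewrite bformZl bformZr mulrA -expr2 mulr_ge0 ?sqr_ge0//.
    by apply: mG; [exact: AG1|exact: AG2].
- by apply: ge_ereal_sup => _ [x [y [tx ty ->]]]; rewrite lee_fin De.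
- move=> x y1 y2 A1y A2y p1 p2; apply: (h0 _ y1 y2).
  have [m1 M1] := proj_argmax j SS AG1 p1 A1y.
  have [m2 M2] := proj_argmax j SS AG2 p2 A2y.
  by split=> //; apply/eqP; rewrite eq_le M1 ?M2//; [exact: AG1|exact: AG2].
Qed.

(** The normalized difference [F] is continuous near (y1, y2), as y1^j - y2^j is nonzero, and S(F,
    F) vanishes at that pair. *)
Lemma cell_good_near (R : realType) (d : nat) (S : 'M[R]_d) (j : 'I_d)
    (delta eps : R) (y1 y2 : 'cV[R]_d) :
  0 < delta -> 0 < eps -> y2 j 0 < y1 j 0 ->
  bform S (y1 - y2) (y1 - y2) = 0 ->
  exists2 r : R, 0 < r & forall A1 A2, A1 `<=` ball y1 r -> A2 `<=` ball y2 r ->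
    cell_good S j delta eps A1 A2.
Proof.
move=> d0 e0 y12 S0.
pose F (z : 'cV[R]_d * 'cV[R]_d) := (z.1 j 0 - z.2 j 0)^-1 *: (z.1 - z.2).
have c1 : {for (y1, y2), continuous (fun z : 'cV[R]_d * 'cV[R]_d => z.1 j 0)}.
  apply: (@continuous_comp _ _ _ fst (fun y : 'cV[R]_d => y j 0)).
    exact: cvg_fst.
  exact: coord_continuous.
have c2 : {for (y1, y2), continuous (fun z : 'cV[R]_d * 'cV[R]_d => z.2 j 0)}.
  apply: (@continuous_comp _ _ _ snd (fun y : 'cV[R]_d => y j 0)).
    exact: cvg_snd.
  exact: coord_continuous.
have cF : {for (y1, y2), continuous F}.
  apply: continuousZ; last by apply: continuousB; [exact: cvg_fst|exact: cvg_snd].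
  apply: continuousV; last exact: continuousB.
  by rewrite /= subr_eq0 gt_eqF.
have cS : {for (y1, y2), continuous (fun z => bform S (F z) (F z))}.
  apply: (@continuous_comp _ _ _ F (fun y => bform S y y)) => //.
  exact: bform_continuous.
(* Two values within [eta] of F(y1, y2) are within 2 eta in sup norm, hence within d (2 eta) <= eps
   in Euclidean norm; [d.+1] makes the denominator visibly positive. *)
pose eta := eps / (2 * d.+1%:R).
have eta0 : 0 < eta by rewrite divr_gt0// mulr_gt0.
(* The points [p] and [q] cut the interval from y2^j to y1^j into thirds. *)
pose p := (y1 j 0 + 2 * y2 j 0) / 3; pose q := (2 * y1 j 0 + y2 j 0) / 3.
have yq : q < y1 j 0 by rewrite /q; lra.
have py : y2 j 0 < p by rewrite /p; lra.
have pq : p < q by rewrite /p /q; lra.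
pose P (z : 'cV[R]_d * 'cV[R]_d) := [/\ q < z.1 j 0, z.2 j 0 < p,
  bform S (F z) (F z) < delta & `|F (y1, y2) - F z| < eta].
have : \forall z \near (y1, y2), P z.
  near=> z; split; near: z.
  - exact: (cvgr_gt _ c1).
  - exact: (cvgr_lt _ c2).
  - apply: (cvgr_lt _ cS); rewrite /F/= bformZl bformZr S0 !mulr0//.
  - by move/cvgrPdist_lt : cF; apply.
move=> /nbhs_ballP[r /= r0 rP]; exists r => // A1 A2 A1r A2r.
have AP a b : A1 a -> A2 b -> _ :=
  fun Aa Ab => rP (a, b) (conj (A1r _ Aa) (A2r _ Ab)).
have tE x : theta j [set a - b | a in A1 & b in A2] x ->
    bform S x x < delta /\ `|F (y1, y2) - x| < eta.
  by move=> [_ [a Aa [b Ab <-]] <-]; have [_ _] := AP _ _ Aa Ab; rewrite /F !mxE.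
split.
(* [P] concerns pairs, and the other set may be empty, so each single point is paired with the
   center of the other ball. *)
- exists p, q; split=> // [a Aa|b Ab].
  + by have [/ltW] := rP (a, y2) (conj (A1r _ Aa) (ballxx _ r0)).
  + by have [_ /ltW] := rP (y1, b) (conj (ballxx _ r0) (A2r _ Ab)).
- by move=> x /tE[/ltW].
- move=> x y /tE[_ xe] /tE[_ ye]; apply: le_trans (enorm_le _) _.
  apply: (@le_trans _ _ (d.+1%:R * (eta + eta))).
    rewrite ler_pM// ?ler_nat//.
    rewrite -(subrKA (F (y1, y2))) (le_trans (ler_normD _ _))// distrC.
    by rewrite lerD// ltW.
  by rewrite /eta le_eqVlt; apply/orP; left; apply/eqP; field.
Unshelve. all: by end_near. Qed.

(** * Rational boxes and the countable covering *)

Definition rat_box (R : realType) (d : nat) (a : 'cV[rat]_d) (k : nat) :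
    set 'cV[R]_d :=
  [set y | forall i, `|y i 0 - ratr (a i 0)| <= k.+1%:R^-1].

Lemma rat_box_compact (R : realType) (d : nat) (a : 'cV[rat]_d) k :
  compact (@rat_box R d a k).
Proof.
apply: cV_bounded_closed_compact.
  exists (`|map_mx (ratr : rat -> R) a| + 1); split; first exact: num_real.
  move=> M aM y ya; apply: mx_norm_le => [|i l].
    by apply: le_trans (ltW aM); rewrite addr_ge0.
  rewrite ord1 -(subrK (ratr (a i 0)) (y i 0)).
  apply: le_trans (ler_normD _ _) _; rewrite addrC; apply: le_trans (ltW aM).
  apply: lerD; last by rewrite (le_trans (ya i))// invf_le1// ler1n.
  by have := mx_coord_le (map_mx (ratr : rat -> R) a) i 0; rewrite mxE.
have -> : rat_box a k = \bigcap_(i in setT)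
    [set y : 'cV[R]_d | `|y i 0 - ratr (a i 0)| <= k.+1%:R^-1].
  by apply/seteqP; split=> [y ya i _|y ya i]; [exact: ya|exact: (ya i I)].
apply: closed_bigI => i _.
apply: (@closed_comp _ _ (fun y : 'cV[R]_d => `|y i 0 - ratr (a i 0)|)
  [set r | r <= k.+1%:R^-1]); last exact: closed_le.
move=> y _; apply: (@continuous_comp _ _ _
  (fun z : 'cV[R]_d => z i 0 - ratr (a i 0)) Num.norm); last exact: norm_continuous.
by apply: continuousB; [exact: coord_continuous|exact: cst_continuous].
Qed.

Lemma rat_box_mem (R : realType) (d : nat) (y : 'cV[R]_d) k :
  exists a, rat_box a k y.
Proof.
have /choice[a aP] (i : 'I_d) : exists q : rat,
    `|y i 0 - ratr q| <= k.+1%:R^-1.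
  have k0 : 0 < k.+1%:R^-1 :> R by rewrite invr_gt0.
  have [q] : exists q : rat, ratr q \in `]y i 0, y i 0 + k.+1%:R^-1[.
    by apply: rat_in_itvoo; rewrite ltrDl.
  rewrite in_itv/= => /andP[yq qy]; exists q.
  by rewrite distrC ger0_norm ?subr_ge0 ?ltW// ltrBlDl.
exists (\col_i a i) => i; rewrite mxE; exact: aP.
Qed.

Lemma rat_box_ball (R : realType) (d : nat) (a : 'cV[rat]_d) k (y : 'cV[R]_d)
    (r : R) :
  rat_box a k y -> 2 * k.+1%:R^-1 < r -> rat_box a k `<=` ball y r.
Proof.
move=> ya kr z za; rewrite -ball_normE /=; apply: le_lt_trans kr.
apply: mx_norm_le => [|i l]; first by rewrite mulr_ge0.
rewrite !mxE ord1 -(subrKA (ratr (a i 0))) mulr_natl mulr2n.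
by apply: le_trans (ler_normD _ _) _; rewrite lerD// distrC.
Qed.

(** Around a pair of projections witnessing membership in [Sigma0], small enough boxes are good. The
    triples of two rational centers and a common size are countable, and [pickle] numbers them. *)
Lemma Sigma0_covering (R : realType) (d : nat) (S : 'M[R]_d) (G : set 'cV[R]_d)
    (j : 'I_d) (delta eps : R) :
  S^T = S -> closed G -> S_monotone S G -> Sigma0 S G j !=set0 ->
  0 < delta -> 0 < eps ->
  exists C h, covering S G j delta C h /\
    forall n, (diam (theta j (C n)) <= eps%:E)%E.
Proof.
move=> SS cG mG [x0 Sx0] d0 e0.
pose cell (a : 'cV[rat]_d) k := G `&` rat_box a k.
have cell_compact a k : compact (cell a k).
  by rewrite /cell setIC; apply: compact_closedI => //; exact: rat_box_compact.
pose usable (i : 'cV[rat]_d * 'cV[rat]_d * nat) :=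
  [/\ cell i.1.1 i.2 !=set0, cell i.1.2 i.2 !=set0 &
      cell_good S j delta eps (cell i.1.1 i.2) (cell i.1.2 i.2)].
have usableP x : Sigma0 S G j x -> exists i, usable i /\
    exists y1 y2, [/\ cell i.1.1 i.2 y1, cell i.1.2 i.2 y2,
      Defs.proj S G x y1 & Defs.proj S G x y2].
  move=> [y1 [y2 [p1 p2 y12 S0]]].
  (* The two projections may be swapped, since S(z, z) is even in z. *)
  wlog lt12 : y1 y2 p1 p2 y12 S0 / y2 j 0 < y1 j 0.
    move=> H; case/lt_total/orP: (y12) => lt12; last exact: (H y1 y2).
    apply: (H y2 y1) => //; first by rewrite eq_sym.
    by rewrite -opprB -scaleN1r bformZl bformZr S0 !mulr0.
  have [r r0 good] := cell_good_near d0 e0 lt12 S0.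
  (* The side 2 / (k + 1) of a box is below [r], so a box containing [y1] or [y2] stays in the ball
     around that point. *)
  have [k kr] : exists k, 2 * k.+1%:R^-1 < r.
    have [k _ kr] := near_infty_natSinv_lt (PosNum (divr_gt0 r0 (ltr0Sn R 1))).
    exists k; rewrite mulrC -ltr_pdivlMr//; exact: (kr k (leqnn k)).
  have [a1 ya1] := rat_box_mem y1 k; have [a2 ya2] := rat_box_mem y2 k.
  have [c1 c2] : cell a1 k y1 /\ cell a2 k y2 by case: p1 p2 => ? _ [].
  exists (a1, a2, k); split; last by exists y1, y2.
  split; [by exists y1|by exists y2|apply: good => z [_]].
  - exact: (rat_box_ball ya1 kr).
  - exact: (rat_box_ball ya2 kr).
have [i0 [ui0 _]] := usableP _ Sx0.
(* Unusable indices are sent to [i0], as no set of the covering may be empty. *)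
pose idx n := if unpickle n is Some i then
  if `[<usable i>] then i else i0 else i0.
have idxP n : usable (idx n).
  by rewrite /idx; case: unpickle => // i; case: asboolP.
have /choice[Ch ChP] n : exists Ch : set 'cV[R]_d * ('cV[R]_d -> R),
    [/\ [/\ compact Ch.1, Ch.1 `<=` diff_set G,
        forall x, Ch.1 x -> 0 < x j 0,
        forall x, theta j Ch.1 x -> 0 <= bform S x x <= delta &
        Hfam j (theta j Ch.1) Ch.2],
        (diam (theta j Ch.1) <= eps%:E)%E &
        forall x y1 y2, cell (idx n).1.1 (idx n).2 y1 ->
          cell (idx n).1.2 (idx n).2 y2 ->
          Defs.proj S G x y1 -> Defs.proj S G x y2 -> Ch.2 (S *m x) = 0].
  have [n1 n2 good] := idxP n.
  have [C [h Ch]] := cell_cover SS mG (@subIsetl _ _ _) (@subIsetl _ _ _)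
    (cell_compact _ _) (cell_compact _ _) n1 n2 good.
  by exists (C, h).
exists (fun n => (Ch n).1), (fun n => (Ch n).2); split; last first.
  by move=> n; have [] := ChP n.
split=> [n|x /usableP[i [ui [y1 [y2 [c1 c2 p1 p2]]]]]]; first by have [] := ChP n.
have idxE : idx (pickle i) = i by rewrite /idx pickleK asboolT.
exists (pickle i) => //=; have [_ _] := ChP (pickle i).
by rewrite idxE; apply; eassumption.
Qed.

Theorem theorem4p7 (R : realType) (d m : nat) (hm : (m <= d)%N)
    (S : 'M[R]_d) (hS : Sdm m S)
    (G : set 'cV[R]_d) (hG : monotone_sets S G) (j : 'I_d)
    (hD : interior (dom_psi S G) !=set0)
    (hSigma : Sigma0 S G j !=set0)
    (delta : R) (hdelta : 0 < delta) :
  (exists (C : nat -> set 'cV[R]_d) (h : nat -> 'cV[R]_d -> R),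
      covering S G j delta C h) /\
  (forall eps : R, 0 < eps ->
    exists (C : nat -> set 'cV[R]_d) (h : nat -> 'cV[R]_d -> R),
      covering S G j delta C h /\
      forall n, (diam (theta j (C n)) < eps%:E)%E).
Proof.
have [SS _ _] := hS; have [cG _ mG] := hG.
(* Half of [eps] turns the weak diameter bound into a strict one. *)
have cov eps (eps0 : 0 < eps) :=
  Sigma0_covering SS cG mG hSigma hdelta (divr_gt0 eps0 (ltr0Sn R 1)).
split=> [|eps eps0].
  by have [C [h [Ch _]]] := cov _ ltr01; exists C, h.
have [C [h [Ch dC]]] := cov _ eps0; exists C, h; split=> // n.
apply: le_lt_trans (dC n) _; rewrite lte_fin.
by rewrite ltr_pdivrMr// ltr_pMr// ltr1n.
Qed.
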